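(* Let $0<p<1$, and for positive integers $n,m$ let $L(n,m)$ denote either $L_1(n,m;p)$ for all $n,m$, or $L_2(n,m;p)$ for all $n,m$, where $L_1(n,m;p)$ is the expected number of tosses of a coin with probability of Heads $p$ until reaching for the first time $n$ Heads or $m$ Tails, and $L_2(n,m;p)$ is the expected number of tosses until reaching for the first time $n$ Heads and $m$ Tails. Then for all integers $n\ge4$, $m\ge1$, $$L(n,m)=\frac{pn+pm-2p+2n-2}{n-1}\,L(n-1,m)-\frac{2pn+2pm-4p+n-1}{n-1}\,L(n-2,m)+\frac{p(m-2+n)}{n-1}\,L(n-3,m),$$ and for all integers $n\ge1$, $m\ge4$, $$L(n,m)=-\frac{pn+pm-2p-n-3m+4}{m-1}\,L(n,m-1)+\frac{2pn+2pm-4p-2n-3m+5}{m-1}\,L(n,m-2)-\frac{(p-1)(m-2+n)}{m-1}\,L(n,m-3).$$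
   Context: Tosses are independent, each giving Heads with probability $p$ and Tails with probability $1-p$. With $H_N,T_N$ the number of Heads and Tails among the first $N$ tosses, $L_1(n,m;p)=\mathbb E[\min\{N: H_N\ge n\text{ or }T_N\ge m\}]$ and $L_2(n,m;p)=\mathbb E[\min\{N: H_N\ge n\text{ and }T_N\ge m\}]$. *)

(* Defs.v *)
From HB Require Import structures.
From mathcomp Require Import all_boot all_order all_algebra.
From mathcomp Require Import all_classical all_reals all_analysis.

Set Implicit Arguments.
Unset Strict Implicit.
Unset Printing Implicit Defensive.

Import Order.TTheory GRing.Theory Num.Theory.
Local Open Scope classical_set_scope.
Local Open Scope ring_scope.

Definition mutually_independent (d d' : measure_display) (T : measurableType d)
    (T' : measurableType d') (R : realType) (P : probability T R)
    (X : nat -> {RV P >-> T'}) : Prop :=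
  forall (s : seq nat) (B : nat -> set T'),
    uniq s -> (forall i, measurable (B i)) ->
    P (\bigcap_(i in [set` s]) (X i @^-1` B i))
    = (\prod_(i <- s) P (X i @^-1` B i))%E.

(* [true] stands for Heads; the i-th toss is [X i], counting from 0. *)
Definition coin_tosses (d : measure_display) (T : measurableType d)
    (R : realType) (P : probability T R) (p : R)
    (X : nat -> {RV P >-> bool}) : Prop :=
  mutually_independent X /\ forall i, P (X i @^-1` [set true]) = p%:E.

Definition heads (T : Type) (X : nat -> T -> bool) (N : nat) (w : T) : nat :=
  (\sum_(i < N) X i w)%N.

Definition tails (T : Type) (X : nat -> T -> bool) (N : nat) (w : T) : nat :=
  (\sum_(i < N) ~~ X i w)%N.

(* The least element of A as an extended real; it is +oo when A is empty. *)
Definition first_time (R : realType) (A : set nat) : \bar R :=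
  ereal_inf [set (N%:R : R)%:E | N in A].

(* Expectations are integrals in \bar R (the library's 'E_P[_] only accepts
   real-valued functions): off a null set the waiting times are finite, but
   they are +oo on, e.g., the path on which all tosses give Heads. *)
Definition L1 (d : measure_display) (T : measurableType d) (R : realType)
    (P : probability T R) (X : nat -> {RV P >-> bool}) (n m : nat) : \bar R :=
  (\int[P]_w first_time R
     [set N | (n <= heads X N w)%N \/ (m <= tails X N w)%N])%E.

Definition L2 (d : measure_display) (T : measurableType d) (R : realType)
    (P : probability T R) (X : nat -> {RV P >-> bool}) (n m : nat) : \bar R :=
  (\int[P]_w first_time R
     [set N | (n <= heads X N w)%N /\ (m <= tails X N w)%N])%E.

(* Main.v *)
Require Import Defs.
From HB Require Import structures.
From mathcomp Require Import all_boot all_order all_algebra.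
From mathcomp Require Import all_classical all_reals all_analysis.
From mathcomp Require Import measurable_realfun ring lra zify.

Set Implicit Arguments.
Unset Strict Implicit.
Unset Printing Implicit Defensive.

Import Order.TTheory GRing.Theory Num.Theory.
Import numFieldNormedType.Exports.
Local Open Scope classical_set_scope.
Local Open Scope ring_scope.

(** Write q = 1 - p.  A waiting time is the sum over N of the indicator that it
exceeds N, so its expectation is the sum over N of the probability that the
goal has not been reached after N tosses ([integral_first_time]).  That event
depends only on the number of Heads among the first N tosses, whose law is
binomial ([heads_prob]).

For L1 the goal is not reached after N tosses when there are a < n Heads and
b < m Tails with a + b = N.  Summing over N gives the finite double sum of
C(a + b, a) p^a q^b over the rectangle a < n, b < m ([L1E]).  For L2 the goal
is not reached when there are fewer than n Heads or fewer than m Tails.  By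
inclusion-exclusion, and because the waiting times for n Heads and for m Tails
have expectations n / p and m / q, L2 = n / p + m / q - L1 ([L2E]).

The asserted recurrence in n is a first-order recurrence for the second
difference of L( . , m) ([step_law]): the coefficients add up to 1 and the
cubic 1 - c1 x + c2 x^2 - c3 x^3 has 1 as a double root, so affine functions of
n are solutions.  The second difference of the rectangle sum is a single term,
- C(k + m, k + 1) p^k q^m ([column_sum_diff]), and the quotient of consecutive
such terms is p (k + m + 1) / (k + 2).  Hence L1 satisfies the law, and so does
L2, which differs from - L1 by an affine function of n.  Exchanging Heads with
Tails and p with q gives the recurrence in m. *)

(** * The recurrence for the closed forms *)

(** The third-order recurrence, shifted to start at [k] and with the
denominator cleared. *)
Definition step_law (R : realFieldType) (p : R) (m : nat) (f : nat -> R) : Prop :=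
  forall k : nat,
    k.+2%:R * (f k.+3 - f k.+2 - (f k.+2 - f k.+1)) =
    p * (k.+1 + m)%:R * (f k.+2 - f k.+1 - (f k.+1 - f k)).

Definition rectangle_sum (R : realFieldType) (p q : R) (n m : nat) : R :=
  \sum_(a < n) \sum_(b < m) 'C(a + b, a)%:R * p ^+ a * q ^+ b.

Lemma rectangle_sumC (R : realFieldType) (p q : R) (n m : nat) :
  rectangle_sum p q n m = rectangle_sum q p m n.
Proof.
rewrite /rectangle_sum exchange_big; apply: eq_bigr => b _; apply: eq_bigr => a _.
by rewrite -bin_sub ?leq_addr// addKn addnC mulrAC.
Qed.

(** Pascal's rule makes both sides change by the same amount when the column
gets one entry longer. *)
Lemma column_sum_diff (R : realFieldType) (p q : R) (k m : nat) : p + q = 1 ->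
  \sum_(b < m) 'C(k.+1 + b, k.+1)%:R * p ^+ k.+1 * q ^+ b
  - \sum_(b < m) 'C(k + b, k)%:R * p ^+ k * q ^+ b
  = - ('C(k + m, k.+1)%:R * p ^+ k * q ^+ m).
Proof.
move=> pq; have -> : p = 1 - q by lra.
elim: m => [|m IHm]; first by rewrite !big_ord0 addn0 bin_small// !mul0r subrr oppr0.
rewrite !big_ord_recr/= opprD addrACA IHm addSn addnS binS natrD !exprS; ring.
Qed.

Lemma rectangle_sum_step_law (R : realFieldType) (p q : R) (m : nat) :
  p + q = 1 -> step_law p m (fun n => rectangle_sum p q n m).
Proof.
move=> pq k; rewrite /rectangle_sum ![\sum_(a < k.+3) _]big_ord_recr/=.
rewrite ![\sum_(a < k.+2) _]big_ord_recr/= ![\sum_(a < k.+1) _]big_ord_recr/=.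
set S := \sum_(i < k) _.
have D0 := column_sum_diff k m pq; have D1 := column_sum_diff k.+1 m pq.
have B : k.+2%:R * 'C(k.+1 + m, k.+2)%:R = (k.+1 + m)%:R * 'C(k + m, k.+1)%:R :> R.
  by rewrite -!natrM addSn -mul_bin_diag.
(* The values of the rectangle sum are S, S + A0, S + A0 + A1, and so on, where
   A0, A1, A2 are the columns k, k + 1, k + 2. *)
set A1 := \sum_(b < m) _ in D0 D1 *; set A0 := \sum_(b < m) _ in D0 *.
set A2 := \sum_(b < m) _ in D1 *.
have -> : S + A0 + A1 + A2 - (S + A0 + A1) - (S + A0 + A1 - (S + A0)) = A2 - A1.
  by ring.
have -> : S + A0 + A1 - (S + A0) - (S + A0 - S) = A1 - A0 by ring.
by rewrite D0 D1 !mulrN !mulrA B exprS; ring.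
Qed.

(** The law is linear and holds for affine functions of [n], whose second
differences vanish. *)
Lemma waiting_time_step_law (R : realFieldType) (p q : R) (m : nat) :
  p + q = 1 ->
  step_law p m (fun n => n%:R / p + m%:R / q - rectangle_sum p q n m).
Proof.
move=> pq k; have := rectangle_sum_step_law m pq k.
set f := rectangle_sum p q => /(congr1 -%R) H.
transitivity (- (k.+2%:R * (f k.+3 m - f k.+2 m - (f k.+2 m - f k.+1 m)))).
  by rewrite -!(natr1 k.+2) -!(natr1 k.+1); ring.
by rewrite H -!(natr1 k.+1) -!(natr1 k); ring.
Qed.

(** The form of the law in which the coefficients of the third-order recurrence
can be read off. *)
Lemma step_law_solved (R : realFieldType) (p : R) (m k : nat) (f : nat -> R) :
  step_law p m f ->
  f k.+3 = f k.+2 + (f k.+2 - f k.+1)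
    + p * (m%:R - 2 + k.+3%:R) / (k.+3%:R - 1) * (f k.+2 - f k.+1 - (f k.+1 - f k)).
Proof.
move=> /(_ k) law.
have N1 : k.+3%:R - 1 = k.+2%:R :> R by rewrite -(natr1 k.+2) addrK.
have Nm : m%:R - 2 + k.+3%:R = (k.+1 + m)%:R :> R.
  by rewrite natrD -(natr1 k.+2) -(natr1 k.+1); ring.
rewrite N1 Nm mulrAC -law mulrC mulKf ?pnatr_eq0//; ring.
Qed.

(** * Binomial weights summed over the number of tosses *)

Definition toss_weight (R : realFieldType) (p q : R) (N a : nat) : R :=
  'C(N, a)%:R * p ^+ a * q ^+ (N - a).

Lemma toss_weightS (R : realFieldType) (p q : R) (N a : nat) :
  toss_weight p q N.+1 a.+1 = p * toss_weight p q N a + q * toss_weight p q N a.+1.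
Proof.
rewrite /toss_weight subSS binS natrD.
have [ltaN|leNa] := ltnP a N; last by rewrite (bin_small (leNa : (N < a.+1)%N)) exprS; ring.
by rewrite -(subnSK ltaN) !exprS; ring.
Qed.

(** The expected number of N such that the first N tosses contain exactly [a]
Heads is 1 / p: the state with [a] Heads lasts for a geometric time.  In
formulas, the partial sums for [a.+1] and [a] differ by a multiple of the
general term, which tends to 0 because the partial sums for [a.+1] are
increasing and bounded. *)
Lemma toss_weight_series (R : realType) (p q : R) (a : nat) :
  0 < p -> 0 < q -> p + q = 1 ->
  series (toss_weight p q ^~ a) @ \oo --> p^-1.
Proof.
move=> p0 q0 pq; elim: a => [|a IHa].
  have -> : toss_weight p q ^~ 0%N = geometric 1 q.
    by apply/funext => N; rewrite /toss_weight/= bin0 expr0 mulr1 !mul1r subn0.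
  have -> : p^-1 = 1 / (1 - q) by rewrite div1r; congr (_^-1); lra.
  by apply: cvg_geometric_series; rewrite gtr0_norm// -pq ltrDr.
have weight_ge0 N b : 0 <= toss_weight p q N b.
  by rewrite /toss_weight !mulr_ge0// exprn_ge0// ltW.
have partial_sum M : series (toss_weight p q ^~ a.+1) M =
    series (toss_weight p q ^~ a) M - p^-1 * toss_weight p q M a.+1.
  apply: (mulfI (lt0r_neq0 p0)); rewrite mulrBr mulrA divff ?lt0r_neq0// mul1r.
  rewrite !seriesEnat/=; elim: M => [|M IHM].
    by rewrite !big_geq// /toss_weight bin0n !mul0r mulr0 subrr.
  rewrite !big_nat_recr//= !mulrDr IHM toss_weightS.
  have -> : q = 1 - p by lra.
  by ring.
have cvg_sum : cvgn (series (toss_weight p q ^~ a.+1)).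
  apply: nondecreasing_is_cvgn.
    by apply/nondecreasing_seqP => M; rewrite seriesEnat/= big_nat_recr//= lerDl.
  exists p^-1 => _ [M _ <-]; apply: (@le_trans _ _ (series (toss_weight p q ^~ a) M)).
    by rewrite partial_sum gerBl mulr_ge0// invr_ge0 ltW.
  rewrite -(cvg_lim _ IHa)//; apply: nondecreasing_cvgn_le; last by apply/cvg_ex; exists p^-1.
  by apply/nondecreasing_seqP => k; rewrite !seriesEnat/= big_nat_recr//= lerDl.
have weight0 := cvg_series_cvg_0 cvg_sum.
rewrite (funext partial_sum) -[X in _ --> X]subr0 -(mulr0 p^-1).
by apply: cvgB => //; apply: cvgM => //; exact: cvg_cst.
Qed.

(** The summand is the probability that the waiting time for [n] Heads exceeds N.
Each number [a] < [n] of Heads contributes 1 / p. *)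
Lemma heads_lt_series (R : realType) (p q : R) (n : nat) :
  0 < p -> 0 < q -> p + q = 1 ->
  series (fun N => \sum_(a < N.+1 | (a < n)%N) toss_weight p q N a) @ \oo
  --> n%:R / p.
Proof.
move=> p0 q0 pq.
have -> : (fun N => \sum_(a < N.+1 | (a < n)%N) toss_weight p q N a) =
          (fun N => \sum_(a < n) toss_weight p q N a).
  apply/funext => N.
  rewrite (big_ord_widen_cond (n + N.+1) (fun a => (a < n)%N) (toss_weight p q N)) ?leq_addl//.
  rewrite [RHS](big_ord_widen (n + N.+1) (toss_weight p q N)) ?leq_addr//.
  rewrite [LHS]big_mkcond [RHS]big_mkcond/=; apply: eq_bigr => a _.
  case: (ltnP a n) => //= _; case: ltnP => // ltNa.
  by rewrite /toss_weight bin_small// !mul0r.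
have -> : series (fun N => \sum_(a < n) toss_weight p q N a) =
          (fun M => \sum_(a < n) series (toss_weight p q ^~ a) M).
  by apply/funext => M; rewrite seriesEnat/= exchange_big.
have -> : n%:R / p = \sum_(a < n) p^-1 by rewrite sumr_const card_ord mulr_natl.
apply: cvg_big => [|a _]; first exact: add_continuous.
exact: toss_weight_series.
Qed.

(** Counting Tails instead of Heads exchanges [p] and [q]. *)
Lemma tails_lt_series (R : realType) (p q : R) (m : nat) :
  0 < p -> 0 < q -> p + q = 1 ->
  series (fun N => \sum_(a < N.+1 | (N - a < m)%N) toss_weight p q N a) @ \oo
  --> m%:R / q.
Proof.
move=> p0 q0 pq.
have -> : (fun N => \sum_(a < N.+1 | (N - a < m)%N) toss_weight p q N a) =
          (fun N => \sum_(b < N.+1 | (b < m)%N) toss_weight q p N b).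
  apply/funext => N; rewrite (reindex_inj rev_ord_inj)/=.
  have le_a (a : 'I_N.+1) : (a <= N)%N by rewrite -ltnS.
  apply: eq_big => [a|a _]; rewrite subSS ?subKn//.
  by rewrite /toss_weight bin_sub// subKn// mulrAC.
by apply: heads_lt_series => //; rewrite addrC.
Qed.

(** Grouping the points of the rectangle by antidiagonals a + b = N turns its sum
into a series whose terms vanish from N = n + m on. *)
Lemma both_lt_series (R : realType) (p q : R) (n m : nat) :
  series (fun N => \sum_(a < N.+1 | (a < n)%N && (N - a < m)%N) toss_weight p q N a)
  @ \oo --> rectangle_sum p q n m.
Proof.
have antidiagonal N :
    \sum_(a < N.+1 | (a < n)%N && (N - a < m)%N) toss_weight p q N a =
    \sum_(a < n) \sum_(b < m | (a + b == N)%N) toss_weight p q (a + b) a.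
  have inner a : \sum_(b < m | (a + b == N)%N) toss_weight p q (a + b) a =
      if (a <= N)%N && (N - a < m)%N then toss_weight p q N a else 0.
    case: ifP => [/andP[aN Nam]|no].
      rewrite (big_pred1 (Ordinal Nam))/= ?subnKC// => b.
      by rewrite /= -val_eqE/=; lia.
    by rewrite big_pred0// => b; apply/negbTE; have := ltn_ord b; lia.
  under [RHS]eq_bigr do rewrite inner.
  rewrite -big_mkcond/=.
  rewrite (big_ord_widen_cond (n + N.+1)
    (fun a => (a < n)%N && (N - a < m)%N) (toss_weight p q N)) ?leq_addl//.
  rewrite [RHS](big_ord_widen_cond (n + N.+1)
    (fun a => (a <= N)%N && (N - a < m)%N) (toss_weight p q N)) ?leq_addr//.
  by apply: eq_bigl => a /=; rewrite ltnS; lia.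
apply: cvg_near_cst; exists (n + m)%N => // M /= nmM.
rewrite seriesEnat/=; under eq_bigr do rewrite antidiagonal.
rewrite exchange_big; apply: eq_bigr => a _.
under eq_bigr do rewrite big_mkcond.
rewrite exchange_big; apply: eq_bigr => b _; rewrite -big_mkcond/= big_mkord.
have abM : (a + b < M)%N by have := ltn_ord a; have := ltn_ord b; lia.
rewrite (big_pred1 (Ordinal abM)) => [|N]; last by rewrite /= -val_eqE/= eq_sym.
by rewrite /toss_weight addKn.
Qed.

(** Inclusion-exclusion. *)
Lemma either_lt_series (R : realType) (p q : R) (n m : nat) :
  0 < p -> 0 < q -> p + q = 1 ->
  series (fun N => \sum_(a < N.+1 | (a < n)%N || (N - a < m)%N) toss_weight p q N a)
  @ \oo --> n%:R / p + m%:R / q - rectangle_sum p q n m.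
Proof.
move=> p0 q0 pq.
set f := (fun N => _); suff -> : series f = (fun M =>
    series (fun N => \sum_(a < N.+1 | (a < n)%N) toss_weight p q N a) M
    + series (fun N => \sum_(a < N.+1 | (N - a < m)%N) toss_weight p q N a) M
    - series (fun N => \sum_(a < N.+1 | (a < n)%N && (N - a < m)%N)
        toss_weight p q N a) M).
  apply: cvgB; last exact: both_lt_series.
  by apply: cvgD; [exact: heads_lt_series|exact: tails_lt_series].
apply/funext => M; rewrite !seriesEnat/= -big_split/= -sumrB.
apply: eq_bigr => N _; rewrite /f.
rewrite big_mkcond [X in X + _ - _]big_mkcond [X in _ + X - _]big_mkcond.
rewrite [X in _ - X]big_mkcond -big_split/= -sumrB; apply: eq_bigr => a _.
by case: (_ < n)%N; case: (_ < m)%N => /=; ring.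
Qed.

(** * Expectation of a first time *)

(** If the event never happens, both sides are +oo. *)
Lemma first_time_series (R : realType) (b : nat -> bool) :
  {homo b : i j / (i <= j)%N >-> i ==> j} ->
  first_time R [set N | b N] = (\sum_(0 <= N <oo) (~~ b N)%:R%:E)%E :> \bar R.
Proof.
move=> b_mono; have [exb|nob] := pselect (exists N, b N).
  case: (ex_minnP exb) => k bk k_min.
  have b_lt N : (N < k)%N -> b N = false.
    by move=> Nk; apply/negP => /k_min; rewrite leqNgt Nk.
  rewrite (nneseries_split 0 k) => [|N _]; last by rewrite lee_fin ler0n.
  rewrite eseries0 => [|N kN _]; last by rewrite (implyP (b_mono _ _ kN) bk).
  rewrite adde0 add0n big_mkord (eq_bigr (fun=> 1%:E)) => [|N _]; last by rewrite b_lt.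
  rewrite sumEFin sumr_const card_ord; apply/eqP; rewrite eq_le; apply/andP; split.
    by apply: ereal_inf_lbound; exists k.
  by apply/ereal_infP => _ [N bN <-]; rewrite lee_fin ler_nat k_min.
have b0 N : b N = false by apply/negP => bN; apply: nob; exists N.
have -> : [set N | b N] = set0 by apply/seteqP; split => // N /=; rewrite b0.
rewrite /first_time image_set0 ereal_inf0.
apply/esym/eqyP => A A0.
apply: (@le_trans _ _ (\sum_(0 <= N < (Num.truncn A).+1) (~~ b N)%:R%:E)); last first.
  by apply: nneseries_lim_ge => N _; rewrite lee_fin ler0n.
rewrite big_mkord (eq_bigr (fun=> 1%:E)) => [|N _]; last by rewrite b0.
by rewrite sumEFin sumr_const card_ord lee_fin ltW// truncnS_gt.
Qed.

Lemma EFin_series (R : realType) (u : R^nat) (l : R) : series u @ \oo --> l ->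
  (\sum_(0 <= N <oo) (u N)%:E = l%:E :> \bar R)%E.
Proof.
move=> ul; rewrite -(cvg_lim (@Rhausdorff R) ul) -EFin_lim; last by apply/cvg_ex; exists l.
by congr (limn _); apply/funext => M; rewrite /= sumEFin.
Qed.

(** The tail-sum formula for expectations, by interchanging the integral with the
nonnegative series of indicators. *)
Lemma integral_first_time (d : measure_display) (T : measurableType d)
    (R : realType) (P : probability T R) (b : T -> nat -> bool) :
  (forall w, {homo b w : i j / (i <= j)%N >-> i ==> j}) ->
  (forall N, measurable [set w | ~~ b w N]) ->
  (\int[P]_w first_time R [set N | b w N] = \sum_(0 <= N <oo) P [set w | ~~ b w N])%E.
Proof.
move=> b_mono mb.
have indicator_notb w N : (~~ b w N)%:R%:E = (\1_[set w | ~~ b w N] w)%:E :> \bar R.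
  by rewrite indicE mem_setE.
rewrite (eq_integral (fun w => \sum_(0 <= N <oo) (\1_[set w | ~~ b w N] w)%:E)%E);
  last first.
  by move=> w _; rewrite first_time_series//; apply: eq_eseriesr => N _; exact: indicator_notb.
rewrite integral_nneseries//.
- by apply: eq_eseriesr => N _; rewrite integral_indic// setIT.
- by move=> N; apply/measurable_EFinP; exact: measurable_indic.
Qed.

(** * The law of the number of Heads *)

(** The first [N] tosses, recorded as the set of the positions of the Heads. *)
Definition outcome (T : Type) (X : nat -> T -> bool) (N : nat) (w : T) :
  {set 'I_N} := [set i : 'I_N | X i w]%SET.

Lemma in_outcome (T : Type) (X : nat -> T -> bool) (N : nat) (w : T) (i : 'I_N) :
  (i \in outcome X N w) = X i w.
Proof. by rewrite /outcome inE. Qed.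

Lemma card_outcome (T : Type) (X : nat -> T -> bool) (N : nat) (w : T) :
  #|outcome X N w| = heads X N w.
Proof.
rewrite /heads -sum1_card big_mkcond; apply: eq_bigr => i _.
by rewrite in_outcome; case: (X i w).
Qed.

Lemma tailsE (T : Type) (X : nat -> T -> bool) (N : nat) (w : T) :
  tails X N w = (N - heads X N w)%N.
Proof.
suff : (heads X N w + tails X N w)%N = N by move=> {2}<-; rewrite addKn.
rewrite /heads /tails -big_split/= (eq_bigr (fun=> 1%N)) => [|i _]; last by case: X.
by rewrite sum1_card card_ord.
Qed.

(** An outcome prescribes each of the first [N] tosses, which is the form of
event in the definition of independence. *)
Lemma outcome_preimageE (T : Type) (X : nat -> T -> bool) (N : nat) (A : {set 'I_N}) :
  outcome X N @^-1` [set A] =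
  \bigcap_(i in [set` iota 0 N]) X i @^-1` [set i \in [seq val j | j in A]].
Proof.
have memA (i : 'I_N) : (val i \in [seq val j | j in A]) = (i \in A).
  by rewrite mem_map ?mem_enum//; exact: val_inj.
apply/seteqP; split => w /=.
  move=> wA i /=; rewrite mem_iota add0n => /= iN.
  by have := memA (Ordinal iN); rewrite -[in RHS]wA in_outcome.
move=> Aw; apply/setP => i; rewrite in_outcome -memA.
by apply: Aw; rewrite /= mem_iota add0n/=.
Qed.

Lemma heads_mono (T : Type) (X : nat -> T -> bool) (w : T) :
  {homo (fun N => heads X N w) : i j / (i <= j)%N}.
Proof.
apply: homo_leq leqnn leq_trans _ => N.
by rewrite /heads big_ord_recr leq_addr.
Qed.

Lemma tails_mono (T : Type) (X : nat -> T -> bool) (w : T) :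
  {homo (fun N => tails X N w) : i j / (i <= j)%N}.
Proof.
apply: homo_leq leqnn leq_trans _ => N.
by rewrite /tails big_ord_recr leq_addr.
Qed.

Section coin_tosses.
Context (d : measure_display) (T : measurableType d) (R : realType)
  (P : probability T R) (p : R) (X : nat -> {RV P >-> bool}).
Context (hX : coin_tosses p X).

Lemma measurable_toss i (c : bool) : measurable (X i @^-1` [set c]).
Proof. by rewrite -[X in measurable X]setTI; apply: measurable_funP. Qed.

Lemma measurable_outcome N (A : {set 'I_N}) : measurable (outcome X N @^-1` [set A]).
Proof.
rewrite outcome_preimageE; apply: fin_bigcap_measurable => [|i _].
  exact: finite_seq.
exact: measurable_toss.
Qed.

Lemma toss_prob i (c : bool) : P (X i @^-1` [set c]) = (if c then p else 1 - p)%:E.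
Proof.
case: c; first exact: hX.2.
rewrite (_ : _ @^-1` _ = ~` (X i @^-1` [set true])).
  by rewrite probability_setC; [rewrite hX.2|exact: measurable_toss].
by apply/seteqP; split => w /=; case: (X i w).
Qed.

Lemma outcome_prob N (A : {set 'I_N}) :
  P (outcome X N @^-1` [set A]) = (p ^+ #|A| * (1 - p) ^+ (N - #|A|))%:E.
Proof.
rewrite outcome_preimageE hX.1 ?iota_uniq//.
under eq_bigr do rewrite toss_prob.
rewrite -(big_morph EFin (@EFinM R) erefl); congr EFin.
rewrite -[N in iota 0 N]subn0 big_mkord (bigID (mem A))/=; congr (_ * _).
  rewrite -prodr_const; apply: eq_bigr => i iA.
  by rewrite mem_map ?mem_enum ?iA//; exact: val_inj.
have -> : (N - #|A|)%N = #|[predC A]|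
  by rewrite -[X in (X - _)%N](card_ord N) -(cardC (mem A)) addKn.
rewrite -prodr_const; apply: eq_bigr => i iA.
by rewrite mem_map ?mem_enum ?(negbTE iA)//; exact: val_inj.
Qed.

Lemma heads_setE (Q : pred nat) N :
  [set w | Q (heads X N w)] =
  \bigcup_(A in [set` enum [pred A : {set 'I_N} | Q #|A|]]) outcome X N @^-1` [set A].
Proof.
apply/seteqP; split => w /=.
  by move=> Qw; exists (outcome X N w) => //=; rewrite mem_enum inE card_outcome.
by move=> [A] /=; rewrite mem_enum inE => QA wA; rewrite -card_outcome wA.
Qed.

Lemma measurable_heads (Q : pred nat) N : measurable [set w | Q (heads X N w)].
Proof.
rewrite heads_setE; apply: fin_bigcup_measurable; first exact: finite_seq.
by move=> A _; exact: measurable_outcome.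
Qed.

(** There are C(N, a) outcomes with [a] Heads. *)
Lemma heads_prob (Q : pred nat) N :
  P [set w | Q (heads X N w)] =
  (\sum_(a < N.+1 | Q a) toss_weight p (1 - p) N a)%:E.
Proof.
rewrite heads_setE measure_fin_bigcup; first last.
- by move=> A _; exact: measurable_outcome.
- exact: trivIset_preimage1.
- exact: finite_seq.
rewrite -fsbig_seq ?enum_uniq// big_enum/=.
under eq_bigr do rewrite outcome_prob.
rewrite sumEFin; congr EFin.
have cardE (A : {set 'I_N}) : val (inord #|A| : 'I_N.+1) = #|A|.
  by rewrite /= inordK// ltnS -[leqRHS]card_ord max_card.
rewrite (partition_big (fun A : {set 'I_N} => inord #|A|) (fun a : 'I_N.+1 => Q a))/=; last first.
  by move=> A; rewrite inE -{1}cardE.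
apply: eq_bigr => a Qa.
rewrite (eq_big (mem [set A : {set 'I_N} | #|A| == a]%SET)
  (fun=> p ^+ a * (1 - p) ^+ (N - a))).
- by rewrite sumr_const card_draws card_ord -mulr_natl mulrA.
- by move=> A; rewrite !inE -val_eqE cardE; case: eqP => [->|]; rewrite ?Qa ?andbF.
- by move=> A /andP[_ /eqP <-]; rewrite cardE.
Qed.

(** The goal is given by its values [Q N a] on the paths with [a] Heads among the
first [N] tosses. *)
Lemma expectation_first_time (Q : nat -> pred nat) (l : R) :
  (forall w, {homo (fun N => Q N (heads X N w)) : i j / (i <= j)%N >-> i ==> j}) ->
  series (fun N => \sum_(a < N.+1 | ~~ Q N a) toss_weight p (1 - p) N a) @ \oo --> l ->
  (\int[P]_w first_time R [set N | Q N (heads X N w)] = l%:E)%E.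
Proof.
move=> Q_mono Ql; rewrite (@integral_first_time _ _ _ _ (fun w N => Q N (heads X N w)))//.
  rewrite -(EFin_series Ql); apply: eq_eseriesr => N _.
  exact: (heads_prob (fun a => ~~ Q N a)).
by move=> N; exact: (measurable_heads (fun a => ~~ Q N a)).
Qed.

(** * The two expectations and the theorem *)

Lemma L1E n m : L1 X n m = (rectangle_sum p (1 - p) n m)%:E.
Proof.
rewrite -(@expectation_first_time (fun N a => (n <= a)%N || (m <= N - a)%N)).
- apply: eq_integral => w _; congr first_time; apply/seteqP.
  by split => N /=; rewrite -tailsE => /orP.
- move=> w i j ij; rewrite -!tailsE; apply/implyP => /orP[ni|mi]; apply/orP.
    by left; rewrite (leq_trans ni)// heads_mono.
  by right; rewrite (leq_trans mi)// tails_mono.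
- rewrite (_ : (fun N => _) = fun N : nat => \sum_(a < N.+1 | (a < n)%N && (N - a < m)%N)
    toss_weight p (1 - p) N a); first exact: both_lt_series.
  by apply/funext => N; apply: eq_bigl => a; rewrite negb_or -!ltnNge.
Qed.

Lemma L2E n m : 0 < p < 1 ->
  L2 X n m = (n%:R / p + m%:R / (1 - p) - rectangle_sum p (1 - p) n m)%:E.
Proof.
case/andP=> p0 p1.
rewrite -(@expectation_first_time (fun N a => (n <= a)%N && (m <= N - a)%N)).
- apply: eq_integral => w _; congr first_time; apply/seteqP.
  by split => N /=; rewrite -tailsE => /andP.
- move=> w i j ij; rewrite -!tailsE; apply/implyP => /andP[ni mi]; apply/andP.
  by rewrite (leq_trans ni) ?(leq_trans mi) ?heads_mono ?tails_mono.
- rewrite (_ : (fun N => _) = fun N : nat => \sum_(a < N.+1 | (a < n)%N || (N - a < m)%N)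
    toss_weight p (1 - p) N a); first by apply: either_lt_series => //; lra.
  by apply/funext => N; apply: eq_bigl => a; rewrite negb_and -!ltnNge.
Qed.

End coin_tosses.

Theorem mainTheorem3 (d : measure_display) (T : measurableType d)
    (R : realType) (P : probability T R) (p : R) (hp : 0 < p < 1)
    (X : nat -> {RV P >-> bool}) (hX : coin_tosses p X)
    (L : nat -> nat -> \bar R)
    (hL : (forall n m : nat, (1 <= n)%N -> (1 <= m)%N -> L n m = L1 X n m) \/
          (forall n m : nat, (1 <= n)%N -> (1 <= m)%N -> L n m = L2 X n m)) :
  (forall n m : nat, (4 <= n)%N -> (1 <= m)%N ->
    L n m =
      (((p * n%:R + p * m%:R - 2 * p + 2 * n%:R - 2) / (n%:R - 1))%:E
         * L (n - 1)%N m
       - ((2 * p * n%:R + 2 * p * m%:R - 4 * p + n%:R - 1) / (n%:R - 1))%:E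
         * L (n - 2)%N m
       + ((p * (m%:R - 2 + n%:R)) / (n%:R - 1))%:E
         * L (n - 3)%N m)%E) /\
  (forall n m : nat, (1 <= n)%N -> (4 <= m)%N ->
    L n m =
      (- ((p * n%:R + p * m%:R - 2 * p - n%:R - 3 * m%:R + 4)
            / (m%:R - 1))%:E
         * L n (m - 1)%N
       + ((2 * p * n%:R + 2 * p * m%:R - 4 * p - 2 * n%:R - 3 * m%:R + 5)
            / (m%:R - 1))%:E
         * L n (m - 2)%N
       - (((p - 1) * (m%:R - 2 + n%:R)) / (m%:R - 1))%:E
         * L n (m - 3)%N)%E).
Proof.
(* L is finite, so the recurrences can be proved for a real-valued f. *)
have [f [LE fhead ftail]] : exists f : nat -> nat -> R,
  [/\ forall n m, (1 <= n)%N -> (1 <= m)%N -> L n m = (f n m)%:E,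
      forall m, step_law p m (f ^~ m) &
      forall n, step_law (1 - p) n (f n)].
  have pq : p + (1 - p) = 1 by ring.
  have qp : (1 - p) + p = 1 by ring.
  case: hL => LE.
    exists (rectangle_sum p (1 - p)); split => [n m n1 m1|m|n].
    - by rewrite LE// (L1E hX).
    - exact: rectangle_sum_step_law.
    - by rewrite (funext (rectangle_sumC _ _ n)); exact: rectangle_sum_step_law.
  exists (fun n m => n%:R / p + m%:R / (1 - p) - rectangle_sum p (1 - p) n m).
  split => [n m n1 m1|m|n].
  - by rewrite LE// (L2E hX _ _ hp).
  - exact: waiting_time_step_law.
  - rewrite (_ : (fun m => _) = fun m => m%:R / (1 - p) + n%:R / p - rectangle_sum (1 - p) p m n).
      exact: waiting_time_step_law.
    by apply/funext => m; rewrite rectangle_sumC [X in X - _]addrC.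
split=> [[|[|[|[|k]]]]// m _ m1|n [|[|[|[|k]]]]// n1 _].
  rewrite !subSS !subn0 !LE// -!EFinM -!EFinB -!EFinD; congr EFin.
  have N1 : k.+4%:R - 1 != 0 :> R by rewrite -natr1 addrK pnatr_eq0.
  rewrite (step_law_solved k.+1 (fhead m)).
  by move: k.+4%:R N1 => N N1; field.
(* The recurrence in m is the law for 1 - p with the roles of n and m exchanged. *)
rewrite !subSS !subn0 !LE// -!EFinN -!EFinM -!EFinD; congr EFin.
have M1 : k.+4%:R - 1 != 0 :> R by rewrite -natr1 addrK pnatr_eq0.
rewrite (step_law_solved k.+1 (ftail n)).
by move: k.+4%:R M1 => M M1; field.
Qed.
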